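(* Let $0<p_0<1$ and $\varepsilon>0$. Then there exists $c$ such that, for any graph $H$ with at least $c$ edges and any sampling probabilities $p_1,p_2$ with $p_0\le p_1<p_2\le 1$, the random variable $q^*(H_{p_1})$ $\varepsilon$-nearly dominates $q^*(H_{p_2})$.
   Context: Graphs are finite and simple. For a graph $G$ with $m\ge 1$ edges and a vertex partition $\mathcal{A}$, the modularity score is $q_{\mathcal{A}}(G)=\frac1m\sum_{A\in\mathcal{A}}e(A)-\frac1{4m^2}\sum_{A\in\mathcal{A}}\mathrm{vol}(A)^2$, where $e(A)$ is the number of edges inside $A$ and $\mathrm{vol}(A)$ is the sum of the degrees of the vertices in $A$. If $G$ has no edges then $q_{\mathcal{A}}(G)=0$. The modularity is $q^*(G)=\max_{\mathcal{A}}q_{\mathcal{A}}(G)$ over all vertex partitions. $H_p$ is the random subgraph of $H$ on the same vertex set obtained by keeping each edge of $H$ independently with probability $p$. For random variables $X$ and $Y$ and $\varepsilon>0$, $X$ $\varepsilon$-nearly (stochastically) dominates $Y$ if $\Pr(X\ge t)\ge\Pr(Y\ge t+\varepsilon)-\varepsilon$ for each real $t$. *)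

(* Defs.v *)
From HB Require Import structures.
From mathcomp Require Import all_boot all_order all_algebra.
From mathcomp Require Export reals.
Set Implicit Arguments.
Unset Strict Implicit.
Unset Printing Implicit Defensive.
Import Order.TTheory GRing.Theory Num.Theory.
Local Open Scope ring_scope.

(* A graph on the vertex set T is given by its set of edges E : {set {set T}};
   it is simple when every edge is an unordered pair of distinct vertices.
   Every subset of a simple edge set is again simple, so a subgraph on the same
   vertex set is just a subset F \subset E. *)
Definition simple_graph (T : finType) (E : {set {set T}}) : bool :=
  [forall e in E, #|e| == 2].

Definition degree (T : finType) (E : {set {set T}}) (v : T) : nat :=
  #|[set e in E | v \in e]|.

Definition vol (T : finType) (E : {set {set T}}) (A : {set T}) : nat :=
  (\sum_(v in A) degree E v)%N.

Definition edges_in (T : finType) (E : {set {set T}}) (A : {set T}) : nat :=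
  #|[set e in E | e \subset A]|.

Definition modularity_score (R : realType) (T : finType) (E : {set {set T}})
    (P : {set {set T}}) : R :=
  let m : R := #|E|%:R in
  if E == set0 then 0
  else m^-1 * (\sum_(A in P) (edges_in E A)%:R)
       - (4 * m ^+ 2)^-1 * (\sum_(A in P) (vol E A)%:R ^+ 2).

Definition singletons (T : finType) : {set {set T}} :=
  [set [set x] | x in [set: T]].

(* The maximum over all partitions of the vertex set.  A maximum needs a
   starting value: we take the score of the partition into singletons, so
   that no extraneous value enters (see modularity_max). *)
Definition modularity (R : realType) (T : finType) (E : {set {set T}}) : R :=
  \big[Num.max/modularity_score R E (singletons T)]_(P : {set {set T}} |
     partition P [set: T]) modularity_score R E P.

Definition Pr (R : realType) (Omega : finType) (mu : Omega -> R)
    (A : pred Omega) : R :=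
  \sum_(w | A w) mu w.

(* X and Y may live on different (finite) probability spaces, with mass
   functions mu and nu. *)
Definition nearly_dominates (R : realType) (eps : R)
    (Omega1 : finType) (mu : Omega1 -> R) (X : Omega1 -> R)
    (Omega2 : finType) (nu : Omega2 -> R) (Y : Omega2 -> R) : Prop :=
  forall t : R,
    Pr nu (fun w => t + eps <= Y w) - eps <= Pr mu (fun w => t <= X w).

(* The law of the random subgraph H_p, as a mass function on edge sets. *)
Definition random_subgraph (R : realType) (p : R) (T : finType)
    (H : {set {set T}}) (F : {set {set T}}) : R :=
  if F \subset H then \prod_(e in H) (if e \in F then p else 1 - p) else 0.

Lemma singletons_partition (T : finType) : partition (singletons T) [set: T].
Proof.
apply/and3P; split.
- rewrite eqEsubset subsetT; apply/subsetP => x _; apply/bigcupP.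
  by exists [set x]; [apply: imset_f; rewrite inE | rewrite inE].
- apply/trivIsetP => _ _ /imsetP[x _ ->] /imsetP[y _ ->] xy.
  by rewrite disjoints1 inE; apply: contra xy => /eqP->.
- by apply/imsetP => -[x _ /setP/(_ x)]; rewrite !inE eqxx.
Qed.

Lemma modularity_max (R : realType) (T : finType) (E : {set {set T}}) :
  (exists2 P, partition P [set: T] & modularity R E = modularity_score R E P)
  /\ (forall P, partition P [set: T] ->
        modularity_score R E P <= modularity R E).
Proof.
split; last by move=> P hP; exact: le_bigmax_cond.
rewrite /modularity; elim/big_ind: _ => [|x y [P hP ->] [Q hQ ->]|P hP].
- by exists (singletons T); first exact: singletons_partition.
- by case: (leP (modularity_score R E P)) => _; [exists Q | exists P].
- by exists P.
Qed.

Lemma random_subgraph_ge0 (R : realType) (p : R) (T : finType)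
    (H F : {set {set T}}) :
  0 <= p <= 1 -> 0 <= random_subgraph p H F.
Proof.
move=> /andP[p0 p1]; rewrite /random_subgraph; case: ifP => // _.
by apply: prodr_ge0 => e _; case: ifP => // _; rewrite subr_ge0.
Qed.

Lemma Pr_random_subgraph_sub (R : realType) (p : R) (T : finType)
    (H S : {set {set T}}) :
  S \subset H ->
  Pr (random_subgraph p H) (fun F => S \subset F) = p ^+ #|S|.
Proof.
move=> SH.
pose f e : R := if e \in H then p else 0.
pose g e : R := if e \in H then (if e \in S then 0 else 1 - p) else 1.
have -> : p ^+ #|S| = \prod_e (f e + g e).
  rewrite -prodr_const big_mkcond; apply: eq_bigr => e _; rewrite /f /g.
  case: ifPn => [eS|eS]; first by rewrite (subsetP SH) // addr0.
  by case: ifP => _; rewrite ?add0r // addrC subrK.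
rewrite bigA_distr /Pr /= big_mkcond; apply: eq_bigr => F _.
rewrite /random_subgraph.
case: (boolP (S \subset F)) => [SF|/subsetPn[e eS eF]]; last first.
  by rewrite (bigD1 e) //= (negPf eF) /g (subsetP SH) // eS mul0r.
case: (boolP (F \subset H)) => [FH|/subsetPn[e eF eH]]; last first.
  by rewrite (bigD1 e) //= eF /f (negPf eH) mul0r.
rewrite big_mkcond; apply: eq_bigr => e _; rewrite /f /g.
case: (boolP (e \in F)) => eF; first by rewrite (subsetP FH).
by case: ifP => // _; rewrite ifN //; apply: contra eF => /(subsetP SF).
Qed.

Lemma random_subgraph_sum1 (R : realType) (p : R) (T : finType)
    (H : {set {set T}}) :
  \sum_F random_subgraph p H F = 1.
Proof.
have := Pr_random_subgraph_sub p (sub0set H); rewrite cards0 expr0 => <-.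
by apply: eq_bigl => F; rewrite sub0set.
Qed.

(* Main.v *)
Require Import Defs.
From mathcomp Require Import all_boot all_order all_algebra.
From mathcomp Require Import reals.
From mathcomp Require Import ring lra.
Set Implicit Arguments.
Unset Strict Implicit.
Unset Printing Implicit Defensive.
Import Order.TTheory GRing.Theory Num.Theory.
Local Open Scope ring_scope.

(** Sampling $H$ with probability $p_2$ and then sampling the result with
    probability $r = p_1/p_2 \ge p_0$ gives $H_{p_1}$
    ([random_subgraph_comp]).  So it suffices to show that, for every graph $G$
    with many edges, the modularity of $G_r$ falls below $q^*(G) - \varepsilon$
    with probability at most $\varepsilon/2$ ([Pr_sample_keeps_score]); the
    remaining $\varepsilon/2$ pays for the event that $H_{p_2}$ has few edges
    ([Pr_few_edges]).

    Fix an optimal partition $P$ of $G$, and let $F$ be a sample of $G$; since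
    $q^*(F) \ge q_P(F)$ it is enough to compare $q_P(F)$ with $q_P(G)$.  The
    number of edges, the number of edges inside parts, and the volume of each
    part are all sums over the sampled edges of a fixed weight, so each has mean
    $r$ times its value on $G$ and variance at most the sum of the squared
    weights ([edge_sum_variance]).  There may be very many parts, each of small
    volume, so the volumes cannot be controlled one by one; but an edge has
    total weight 2 over the parts, so the squared volume deviations, summed over
    all parts, have mean at most $4m$, where $m$ is the number of edges of $G$
    ([mean_sampling_error]).  By Markov's inequality the vector of volumes is
    within $\delta m$ of its mean in Euclidean norm, with high probability once
    $m$ is large.  Then the sum of squared volumes changes relatively little too,
    and so does the score ([score_perturbation], [score_stable]). *)

Section Finite.
Variable R : realType.

(** * Finite sums and probabilities *)

Lemma markov_finite (Omega : finType) (mu X : Omega -> R) (B a b : R) :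
  (forall w, 0 <= mu w) -> (forall w, 0 <= X w) ->
  \sum_w mu w * X w <= B -> 0 < a -> B <= b * a ->
  Pr mu (fun w => a < X w) <= b.
Proof.
move=> mu0 X0 leB a0 leb; rewrite -(ler_pM2r a0) (le_trans _ leb) //.
apply: le_trans leB; rewrite /Pr mulr_suml big_mkcond /=.
apply: ler_sum => w _; case: ifP => [/ltW aX|_]; last exact: mulr_ge0.
exact: ler_wpM2l.
Qed.

Lemma PrC (Omega : finType) (mu : Omega -> R) (A : pred Omega) :
  \sum_w mu w = 1 -> Pr mu (predC A) = 1 - Pr mu A.
Proof. by move=> <-; rewrite /Pr (bigID A predT) /= addrC addrK. Qed.

Lemma le_Pr (Omega : finType) (mu : Omega -> R) (A B : pred Omega) :
  (forall w, 0 <= mu w) -> (forall w, A w -> B w) -> Pr mu A <= Pr mu B.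
Proof.
move=> mu0 AB; rewrite /Pr big_mkcond [leRHS]big_mkcond.
apply: ler_sum => w _; case: ifP => [/AB ->//|_]; by case: ifP.
Qed.

Lemma sum_sqr_le_sqr_sum (I : finType) (D : pred I) (x : I -> R) :
  (forall i, 0 <= x i) -> \sum_(i | D i) x i ^+ 2 <= (\sum_(i | D i) x i) ^+ 2.
Proof.
move=> x0; rewrite [leRHS]expr2 mulr_suml; apply: ler_sum => i Di.
rewrite expr2 ler_wpM2l // (bigD1 i) //= lerDl; exact: sumr_ge0.
Qed.

(** The weighted form of $2xy \le l x^2 + l^{-1} y^2$.  With $y$ much smaller
    than $x$, a small $l$ makes the sum of squares of $x + y$ close to that of
    $x$, which is all that is needed from the triangle inequality for the
    Euclidean norm. *)
Lemma sum_sqrD_le (I : finType) (D : pred I) (x y : I -> R) (l : R) : 0 < l ->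
  \sum_(i | D i) (x i + y i) ^+ 2 <=
  (1 + l) * (\sum_(i | D i) x i ^+ 2) + (1 + l^-1) * (\sum_(i | D i) y i ^+ 2).
Proof.
move=> l0; rewrite !mulr_sumr -big_split; apply: ler_sum => i _ /=.
rewrite -subr_ge0.
have -> : (1 + l) * x i ^+ 2 + (1 + l^-1) * y i ^+ 2 - (x i + y i) ^+ 2
  = l^-1 * (l * x i - y i) ^+ 2 by field; exact: lt0r_neq0.
by rewrite mulr_ge0 ?sqr_ge0 // invr_ge0 ltW.
Qed.

(** * The law of the random subgraph *)

(** A product over all potential edges, without the case distinction on
    inclusion in [H]: in this form two-stage sampling factorises edge by edge. *)
Lemma random_subgraphE (p : R) (T : finType) (H F : {set {set T}}) :
  random_subgraph p H F = \prod_e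
    (if e \in F then (if e \in H then p else 0)
     else (if e \in H then 1 - p else 1)).
Proof.
rewrite /random_subgraph; case: (boolP (F \subset H)) => [FH|]; last first.
  by case/subsetPn=> e eF eH; rewrite (bigD1 e) //= eF (negPf eH) mul0r.
rewrite big_mkcond; apply: eq_bigr => e _.
by case: (boolP (e \in F)) => // /(subsetP FH) ->.
Qed.

(** Sampling twice keeps an edge with probability $pr$.  The sum over the
    intermediate graph [G] is the expansion of a product over the edges of
    two-term sums, the terms [f e] and [g e] telling whether $e$ survives the
    first stage. *)
Lemma random_subgraph_comp (p r : R) (T : finType) (H F : {set {set T}}) :
  \sum_(G : {set {set T}}) random_subgraph p H G * random_subgraph r G F =
  random_subgraph (p * r) H F.
Proof.
pose f e : R := if e \in H then p * (if e \in F then r else 1 - r) else 0.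
pose g e : R := if e \in F then 0 else if e \in H then 1 - p else 1.
rewrite random_subgraphE (eq_bigr (fun e => f e + g e)); last first.
  by move=> e _; rewrite /f /g; case: ifP => _; case: ifP => _; ring.
rewrite bigA_distr; apply: eq_bigr => G _.
rewrite !random_subgraphE -big_split; apply: eq_bigr => e _ /=.
rewrite /f /g; case: (e \in G); case: (e \in H); case: (e \in F); ring.
Qed.

Lemma Pr_random_subgraph_comp (p r : R) (T : finType) (H : {set {set T}})
    (A : pred {set {set T}}) :
  Pr (random_subgraph (p * r) H) A =
  \sum_(G : {set {set T}}) random_subgraph p H G * Pr (random_subgraph r G) A.
Proof.
rewrite /Pr; under eq_bigr do rewrite -random_subgraph_comp.
by rewrite exchange_big; apply: eq_bigr => G _; rewrite mulr_sumr.
Qed.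

(** * Second moments of sums over the sampled edges *)

Section EdgeStatistics.
Variables (p : R) (T : finType) (G : {set {set T}}).

Lemma edge_covariance e f : e \in G -> f \in G ->
  \sum_(F : {set {set T}}) random_subgraph p G F *
    (((e \in F)%:R - p) * ((f \in F)%:R - p)) =
  if e == f then p * (1 - p) else 0.
Proof.
have incl (S : {set {set T}}) : S \subset G ->
    \sum_(F : {set {set T}}) random_subgraph p G F * (S \subset F)%:R =
    p ^+ #|S|.
  move=> /(Pr_random_subgraph_sub p) <-; rewrite /Pr [RHS]big_mkcond.
  by apply: eq_bigr => F _; case: ifP; rewrite ?mulr1 ?mulr0.
move=> eG fG.
have efG : [set e; f] \subset G by rewrite subUset !sub1set eG.
have eG1 : [set e] \subset G by rewrite sub1set.
have fG1 : [set f] \subset G by rewrite sub1set.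
transitivity (\sum_(F : {set {set T}})
   (random_subgraph p G F * ([set e; f] \subset F)%:R
    - p * (random_subgraph p G F * ([set e] \subset F)%:R)
    - p * (random_subgraph p G F * ([set f] \subset F)%:R)
    + p ^+ 2 * random_subgraph p G F)).
  apply: eq_bigr => F _; rewrite subUset !sub1set.
  by case: (e \in F); case: (f \in F) => /=; ring.
rewrite big_split /= !sumrB -!mulr_sumr !incl // random_subgraph_sum1.
by rewrite cards2 !cards1; case: eqP => _ /=; ring.
Qed.

(** The indicators of different edges are uncorrelated, so only the diagonal
    terms of the expanded square remain. *)
Lemma edge_sum_variance (a : {set T} -> R) :
  \sum_(F : {set {set T}}) random_subgraph p G F *
    (\sum_(e in F) a e - p * \sum_(e in G) a e) ^+ 2 =
  p * (1 - p) * \sum_(e in G) a e ^+ 2.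
Proof.
transitivity (\sum_(F : {set {set T}}) \sum_(e in G) \sum_(f in G)
   a e * a f * (random_subgraph p G F *
    (((e \in F)%:R - p) * ((f \in F)%:R - p)))).
  apply: eq_bigr => F _; case: (boolP (F \subset G)) => FG; last first.
    have -> : random_subgraph p G F = 0 by rewrite /random_subgraph (negPf FG).
    rewrite mul0r big1 // => e _; rewrite big1 // => f _.
    by rewrite mul0r mulr0.
  have -> : \sum_(e in F) a e - p * \sum_(e in G) a e =
      \sum_(e in G) a e * ((e \in F)%:R - p).
    have -> : \sum_(e in F) a e = \sum_(e in G) a e * (e \in F)%:R.
      rewrite [RHS](eq_bigr (fun e => if e \in F then a e else 0)); last first.
        by move=> e _; case: ifP; rewrite ?mulr1 ?mulr0.
      rewrite -big_mkcondr; apply: eq_bigl => e /=.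
      by case: (boolP (e \in F)) => [/(subsetP FG) ->|]; rewrite ?andbF.
    by rewrite mulr_sumr -sumrB; apply: eq_bigr => e _; rewrite mulrBr (mulrC p).
  rewrite expr2 big_distrlr mulr_sumr; apply: eq_bigr => e _.
  rewrite mulr_sumr; apply: eq_bigr => f _ /=.
  by move: (_%:R - p) (_%:R - p) (random_subgraph p G F) => x y z; ring.
rewrite exchange_big mulr_sumr; apply: eq_bigr => e eG /=.
rewrite exchange_big /= (bigD1 e) //= [X in _ + X]big1 => [|f /andP[fG fe]].
  by rewrite addr0 -mulr_sumr edge_covariance // eqxx; ring.
by rewrite -mulr_sumr edge_covariance // eq_sym (negPf fe) mulr0.
Qed.

Lemma edge_sum_variance_le (a : {set T} -> R) : 0 <= p <= 1 ->
  \sum_(F : {set {set T}}) random_subgraph p G F *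
    (\sum_(e in F) a e - p * \sum_(e in G) a e) ^+ 2 <=
  \sum_(e in G) a e ^+ 2.
Proof.
move=> /andP[p0 p1]; rewrite edge_sum_variance ler_piMl //.
  by apply: sumr_ge0 => e _; exact: sqr_ge0.
by nra.
Qed.

End EdgeStatistics.

(** * Modularity statistics as sums over edges *)

Lemma card_filter_sum (T : finType) (A : {set T}) (Q : pred T) :
  #|[set x in A | Q x]| = (\sum_(x in A) Q x)%N.
Proof.
by rewrite -sum1dep_card big_mkcondr; apply: eq_bigr => x _; case: (Q x).
Qed.

Lemma card_setI_sum (T : finType) (A B : {set T}) :
  #|A :&: B| = (\sum_(x in B) (x \in A))%N.
Proof.
rewrite setIC -card_filter_sum setIdE; congr #|_ :&: _|.
by apply/setP => x; rewrite inE.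
Qed.

Lemma card_edge_sum (T : finType) (F : {set {set T}}) :
  #|F|%:R = \sum_(e in F) 1 :> R.
Proof. by rewrite sumr_const. Qed.

Lemma vol_edge_sum (T : finType) (F : {set {set T}}) (A : {set T}) :
  (vol F A)%:R = \sum_(e in F) #|e :&: A|%:R :> R.
Proof.
rewrite -natr_sum /vol; congr (_%:R).
rewrite (eq_bigr _ (fun v _ => card_filter_sum F (fun e => v \in e))).
by rewrite exchange_big; apply: eq_bigr => e _ /=; rewrite card_setI_sum.
Qed.

(** For an edge and a partition this is 0 or 1; writing it as a sum makes the
    number of edges inside parts a sum over edges. *)
Definition parts_around (T : finType) (P : {set {set T}}) (e : {set T}) : R :=
  \sum_(A in P) (e \subset A)%:R.

Lemma edges_in_edge_sum (T : finType) (P F : {set {set T}}) :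
  \sum_(A in P) (edges_in F A)%:R = \sum_(e in F) parts_around P e.
Proof.
rewrite /parts_around exchange_big; apply: eq_bigr => A _ /=.
by rewrite -natr_sum /edges_in card_filter_sum.
Qed.

Section Partition.
Variables (T : finType) (P : {set {set T}}).
Hypothesis partP : partition P [set: T].

Lemma sum_card_parts (e : {set T}) :
  \sum_(A in P) #|e :&: A|%:R = #|e|%:R :> R.
Proof.
rewrite -natr_sum; congr (_%:R).
rewrite -[in RHS](setIT e) card_setI_sum (set_partition_big _ partP).
by apply: eq_bigr => A _; rewrite card_setI_sum.
Qed.

Lemma sum_sqr_card_parts (e : {set T}) : #|e| = 2 ->
  \sum_(A in P) #|e :&: A|%:R ^+ 2 <= 4 :> R.
Proof.
move=> e2.
apply: le_trans (@sum_sqr_le_sqr_sum _ _ (fun A => #|e :&: A|%:R) _) _ => //.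
by rewrite sum_card_parts e2; lra.
Qed.

(** A part containing the edge $e$ takes up both of its ends, so it
    contributes 2 to the sum of [#|e :&: A|] over the parts, which is 2. *)
Lemma parts_around_bounds (e : {set T}) : #|e| = 2 -> 0 <= parts_around P e <= 1.
Proof.
move=> e2; rewrite /parts_around sumr_ge0 //= -/(parts_around P e).
suff: 2 * parts_around P e <= #|e|%:R by rewrite e2; lra.
rewrite -sum_card_parts mulr_sumr; apply: ler_sum => A _.
case: (boolP (e \subset A)) => [/setIidPl ->|_]; first by rewrite e2 mulr1.
by rewrite mulr0.
Qed.

End Partition.

(** * Sampling a graph with a fixed partition *)

Section Sampling.
Variables (T : finType) (P G : {set {set T}}).
Hypothesis partP : partition P [set: T].
Hypothesis simpleG : simple_graph G.

Let edge2 e : e \in G -> #|e| = 2.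
Proof. by move=> eG; apply/eqP; move/forall_inP: simpleG => /(_ e eG). Qed.

Lemma sum_edges_in_le : \sum_(A in P) (edges_in G A)%:R <= #|G|%:R :> R.
Proof.
rewrite edges_in_edge_sum card_edge_sum; apply: ler_sum => e /edge2 e2.
by case/andP: (parts_around_bounds partP e2).
Qed.

Lemma sum_sqr_vol_le : \sum_(A in P) (vol G A)%:R ^+ 2 <= 4 * #|G|%:R ^+ 2 :> R.
Proof.
apply: (le_trans (@sum_sqr_le_sqr_sum _ _ (fun A => (vol G A)%:R) _)) => //.
have -> : \sum_(A in P) (vol G A)%:R = 2 * #|G|%:R :> R.
  rewrite (eq_bigr _ (fun A _ => vol_edge_sum G A)) exchange_big /=.
  rewrite card_edge_sum mulr_sumr; apply: eq_bigr => e /edge2 e2.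
  by rewrite sum_card_parts // e2 mulr1.
by rewrite exprMn; lra.
Qed.

(** One quantity bounding all deviations at once, so that a single use of
    Markov's inequality controls everything that enters the score. *)
Definition sampling_error (r : R) (F : {set {set T}}) : R :=
  (#|F|%:R - r * #|G|%:R) ^+ 2
  + (\sum_(A in P) (edges_in F A)%:R
     - r * \sum_(A in P) (edges_in G A)%:R) ^+ 2
  + \sum_(A in P) ((vol F A)%:R - r * (vol G A)%:R) ^+ 2.

Lemma sampling_error_ge0 (r : R) F : 0 <= sampling_error r F.
Proof. by rewrite !addr_ge0 ?sqr_ge0 // sumr_ge0 // => A _; exact: sqr_ge0. Qed.

(** Each edge contributes at most 1 to the variance of the number of edges, at
    most 1 to that of the edges inside parts, and at most 4 to the variances of
    the volumes together, whatever the number of parts. *)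
Lemma mean_sampling_error (r : R) : 0 <= r <= 1 ->
  \sum_F random_subgraph r G F * sampling_error r F <= 6 * #|G|%:R.
Proof.
move=> r01.
rewrite (eq_bigr (fun F =>
    random_subgraph r G F * (\sum_(e in F) 1 - r * \sum_(e in G) 1) ^+ 2
  + random_subgraph r G F *
      (\sum_(e in F) parts_around P e - r * \sum_(e in G) parts_around P e) ^+ 2
  + \sum_(A in P) random_subgraph r G F *
      (\sum_(e in F) #|e :&: A|%:R - r * \sum_(e in G) #|e :&: A|%:R) ^+ 2));
  last first.
  move=> F _; rewrite /sampling_error !edges_in_edge_sum !card_edge_sum.
  rewrite !mulrDr; congr (_ + _); rewrite [LHS]mulr_sumr; apply: eq_bigr => A _.
  by rewrite !vol_edge_sum.
rewrite !big_split /= [X in _ + X <= _]exchange_big /=.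
have c1 : \sum_(e in G) (1 : R) ^+ 2 <= #|G|%:R.
  by rewrite card_edge_sum; apply: ler_sum => e _; rewrite expr1n.
have c2 : \sum_(e in G) parts_around P e ^+ 2 <= #|G|%:R.
  rewrite card_edge_sum; apply: ler_sum => e /edge2 e2.
  by have := parts_around_bounds partP e2; nra.
have c3 : \sum_(A in P) \sum_(e in G) #|e :&: A|%:R ^+ 2 <= 4 * #|G|%:R :> R.
  rewrite exchange_big card_edge_sum mulr_sumr; apply: ler_sum => e /edge2 e2.
  by rewrite mulr1 sum_sqr_card_parts.
have b1 := edge_sum_variance_le G (fun=> 1) r01.
have b2 := edge_sum_variance_le G (parts_around P) r01.
have b3 : \sum_(A in P) \sum_F random_subgraph r G F *
      (\sum_(e in F) #|e :&: A|%:R - r * \sum_(e in G) #|e :&: A|%:R) ^+ 2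
   <= \sum_(A in P) \sum_(e in G) #|e :&: A|%:R ^+ 2 :> R.
  by apply: ler_sum => A _; exact: edge_sum_variance_le.
have -> : 6 * #|G|%:R = #|G|%:R + #|G|%:R + 4 * #|G|%:R :> R by ring.
apply: lerD; first apply: lerD.
- exact: le_trans b1 c1.
- exact: le_trans b2 c2.
- exact: le_trans b3 c3.
Qed.

(** The comparison of scores after normalisation by the number $m$ of edges of
    the sampled graph: $x$ is the fraction of edges kept, $j$ and $j'$ are the
    numbers of edges inside parts over $m$, and $W$ and $W'$ are the sums of
    squared volumes over $m^2$.  Since $x \ge p_0/2$, the first term of the score
    loses at most $2d/x \le 4d/p_0$ and the second at most
    $14d/(4x^2) \le 14d/p_0^2$, in total at most $18d/p_0^2$. *)
Lemma score_perturbation (p0 eps r d x j j' W W' : R) :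
  0 < p0 -> p0 <= r -> r <= 1 -> 0 < d ->
  18 * d <= p0 ^+ 2 -> 18 * d <= p0 ^+ 2 * eps ->
  `|x - r| <= d -> `|j' - r * j| <= d -> 0 <= j <= 1 ->
  0 <= W <= 4 -> W' <= r ^+ 2 * W + 6 * d ->
  0 < x /\ j - W / 4 - eps <= j' / x - W' / (4 * x ^+ 2).
Proof.
move=> p00 p0r r1 d0 dp dpe; rewrite !ler_norml.
move=> /andP[x1 x2] /andP[j1 j2] /andP[j3 j4] /andP[W0 W4] W'le.
have dp2 : d <= p0 / 2 by nra.
have x0 : p0 / 2 <= x by lra.
have x_gt0 : 0 < x by lra.
split=> //.
have hj : x * j - 2 * d <= j' by nra.
have rx : r ^+ 2 - x ^+ 2 <= 2 * d.
  have -> : r ^+ 2 - x ^+ 2 = (r - x) * (r + x) by ring.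
  by case: (lerP r x) => rx; nra.
have hW : W' <= x ^+ 2 * W + 14 * d by nra.
have xe : 4 * x * d + 7 * d <= 2 * x ^+ 2 * eps.
  have pe : 0 < p0 ^+ 2 by rewrite exprn_gt0.
  have eps0 : 0 < eps by rewrite -(pmulr_rgt0 _ pe); lra.
  have px : p0 ^+ 2 <= 4 * x ^+ 2 by nra.
  have px1 : p0 ^+ 2 <= 2 * x by nra.
  have d9 : 9 * d <= x * eps by nra.
  have d18 : 18 * d <= 4 * x ^+ 2 * eps by nra.
  nra.
rewrite -subr_ge0.
have -> : j' / x - W' / (4 * x ^+ 2) - (j - W / 4 - eps) =
  (4 * x * (j' - x * j) + (x ^+ 2 * W - W') + 4 * x ^+ 2 * eps) / (4 * x ^+ 2).
  by field; exact: lt0r_neq0.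
rewrite divr_ge0 //; last by nra.
nra.
Qed.

(** The normalised error of the sum of squared volumes is at most $6d$: with the
    parameter $l = d$ in [sum_sqrD_le], the factor $1 + d$ adds at most $4d$
    because the normalised sum for $G$ is at most 4, and the deviations add at
    most $(1 + 1/d)d^2 \le 2d$. *)
Lemma score_stable (p0 eps r d : R) F :
  0 < p0 -> p0 <= r -> r <= 1 -> 0 < d ->
  18 * d <= p0 ^+ 2 -> 18 * d <= p0 ^+ 2 * eps -> (0 < #|G|)%N ->
  sampling_error r F <= (d * #|G|%:R) ^+ 2 ->
  modularity_score R G P - eps <= modularity_score R F P.
Proof.
move=> p00 p0r r1 d0 dp dpe G0.
have nonempty (E : {set {set T}}) : (0 < #|E|)%N -> (E == set0) = false.
  by rewrite card_gt0 => /negPf.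
rewrite /sampling_error /modularity_score (nonempty G G0).
have := sum_edges_in_le; have := sum_sqr_vol_le.
have : (0 : R) <= \sum_(A in P) (edges_in G A)%:R by exact: sumr_ge0.
have : (0 : R) <= \sum_(A in P) (vol G A)%:R ^+ 2.
  by apply: sumr_ge0 => A _; exact: sqr_ge0.
have := @sum_sqrD_le _ (mem P) (fun A => r * (vol G A)%:R)
  (fun A => (vol F A)%:R - r * (vol G A)%:R) d d0.
rewrite /=; under eq_bigr do rewrite addrC subrK.
under [in leRHS]eq_bigr do rewrite exprMn.
rewrite -mulr_sumr /=.
have D0 : (0 : R) <= \sum_(A in P) ((vol F A)%:R - r * (vol G A)%:R) ^+ 2.
  by apply: sumr_ge0 => A _; exact: sqr_ge0.
move: D0.
set D := \sum_(A in P) _ ^+ 2; set V := \sum_(A in P) (vol G A)%:R ^+ 2.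
set V' := \sum_(A in P) (vol F A)%:R ^+ 2.
set i := \sum_(A in P) (edges_in G A)%:R.
set i' := \sum_(A in P) (edges_in F A)%:R.
have m0 : 0 < #|G|%:R :> R by rewrite ltr0n.
move: m0; set m := #|G|%:R => m0.
move=> D0 V'le V0 i0 V4 i1 err.
have dm0 : 0 < d * m by exact: mulr_gt0.
have e1 : `|#|F|%:R - r * m| <= d * m.
  rewrite -ler_sqr ?nnegrE ?(ltW dm0) // real_normK ?num_real //.
  by have := sqr_ge0 (i' - r * i); lra.
have e2 : `|i' - r * i| <= d * m.
  rewrite -ler_sqr ?nnegrE ?(ltW dm0) // real_normK ?num_real //.
  by have := sqr_ge0 (#|F|%:R - r * m); lra.
have e3 : D <= (d * m) ^+ 2.
  by have := sqr_ge0 (#|F|%:R - r * m); have := sqr_ge0 (i' - r * i); lra.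
have d1 : d <= 1 by nra.
have V'le2 : V' <= r ^+ 2 * V + 6 * d * m ^+ 2.
  apply: (le_trans V'le).
  have : (1 + d^-1) * D <= (1 + d^-1) * (d * m) ^+ 2.
    by rewrite ler_wpM2l // addr_ge0 // invr_ge0 ltW.
  have -> : (1 + d^-1) * (d * m) ^+ 2 = (d ^+ 2 + d) * m ^+ 2.
    by field; exact: lt0r_neq0.
  have : d * (r ^+ 2 * V) <= d * (4 * m ^+ 2).
    rewrite ler_wpM2l ?(ltW d0) //; apply: le_trans V4; rewrite ler_piMl //.
    by nra.
  have : d * (d * m ^+ 2) <= d * m ^+ 2.
    by rewrite ler_wpM2l ?(ltW d0) //; rewrite ler_piMl ?sqr_ge0.
  by lra.
have mn0 : m != 0 by exact: lt0r_neq0.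
have [|||||x0 le_score] := @score_perturbation p0 eps r d (#|F|%:R / m)
  (i / m) (i' / m) (V / m ^+ 2) (V' / m ^+ 2) p00 p0r r1 d0 dp dpe.
- have -> : #|F|%:R / m - r = (#|F|%:R - r * m) / m by field.
  by rewrite normrM (gtr0_norm (x := m^-1)) ?invr_gt0 // ler_pdivrMr.
- have -> : i' / m - r * (i / m) = (i' - r * i) / m by field.
  by rewrite normrM (gtr0_norm (x := m^-1)) ?invr_gt0 // ler_pdivrMr.
- by rewrite divr_ge0 ?(ltW m0) //= ler_pdivrMr // mul1r.
- by rewrite divr_ge0 ?sqr_ge0 //= ler_pdivrMr ?exprn_gt0.
- rewrite ler_pdivrMr ?exprn_gt0 // mulrDl -mulrA divfK //.
  by rewrite expf_neq0.
have F0 : (0 < #|F|)%N.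
  by rewrite -(ltr0n R) -(pmulr_lgt0 _ (x := m^-1)) ?invr_gt0.
rewrite (nonempty F F0); have n0 : #|F|%:R != 0 :> R by rewrite pnatr_eq0 -lt0n.
have -> : m^-1 * i - (4 * m ^+ 2)^-1 * V = i / m - V / m ^+ 2 / 4 by field.
apply: (le_trans le_score); rewrite le_eqVlt; apply/orP; left.
by apply/eqP; field; rewrite n0.
Qed.

(** Used with [P] an optimal partition of [G]; [P] then witnesses a high
    modularity of the sample whenever the sampling error is small. *)
Lemma Pr_sample_keeps_score (p0 eps r d t : R) :
  0 < p0 -> p0 <= r -> r <= 1 -> 0 < d ->
  18 * d <= p0 ^+ 2 -> 18 * d <= p0 ^+ 2 * eps -> (0 < #|G|)%N ->
  12 <= eps * d ^+ 2 * #|G|%:R ->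
  t + eps <= modularity_score R G P ->
  1 - eps / 2 <= Pr (random_subgraph r G) (fun F => t <= modularity R F).
Proof.
move=> p00 p0r r1 d0 dp dpe G0 G12 tG.
have r01 : 0 <= r <= 1 by lra.
have rs0 F : 0 <= random_subgraph r G F by exact: random_subgraph_ge0.
pose bad F := (d * #|G|%:R) ^+ 2 < sampling_error r F.
have badP : Pr (random_subgraph r G) bad <= eps / 2.
  apply: (markov_finite rs0 (sampling_error_ge0 r) (mean_sampling_error r01)).
    by rewrite exprn_gt0 // mulr_gt0 // ltr0n.
  have -> : eps / 2 * (d * #|G|%:R) ^+ 2 =
    (eps * d ^+ 2 * #|G|%:R) / 2 * #|G|%:R by field.
  by rewrite ler_wpM2r // ; lra.
have := PrC bad (random_subgraph_sum1 r G).
have : Pr (random_subgraph r G) (predC bad) <=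
    Pr (random_subgraph r G) (fun F => t <= modularity R F).
  apply: le_Pr => // F; rewrite /= -leNgt => err.
  have := score_stable p00 p0r r1 d0 dp dpe G0 err.
  by have := (modularity_max R F).2 P partP; lra.
by lra.
Qed.

End Sampling.

(** * Proof of near domination *)

(** Having fewer than half of $p_0 |H|$ edges means a deviation of more than
    $p_0|H|/2$ from the mean, while the variance is at most $|H|$. *)
Lemma Pr_few_edges (p0 p : R) (T : finType) (H : {set {set T}}) (b : R) :
  0 < p0 -> p0 <= p -> p <= 1 -> (0 < #|H|)%N ->
  4 <= b * p0 ^+ 2 * #|H|%:R ->
  Pr (random_subgraph p H) (fun F => #|F|%:R < p0 * #|H|%:R / 2) <= b.
Proof.
move=> p00 p0p p1 H0 big.
have p01 : 0 <= p <= 1 by lra.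
have rs0 F : 0 <= random_subgraph p H F by exact: random_subgraph_ge0.
have h0 : 0 < #|H|%:R :> R by rewrite ltr0n.
have var := edge_sum_variance_le H (fun=> 1) p01.
have a0 : 0 < (p0 * #|H|%:R / 2) ^+ 2 by rewrite exprn_gt0 // divr_gt0 ?mulr_gt0.
apply: le_trans (markov_finite (b := b) rs0 (fun F => sqr_ge0 _) var a0 _).
  apply: le_Pr => // F; rewrite -!card_edge_sum => few.
  have : p0 * #|H|%:R <= p * #|H|%:R by rewrite ler_wpM2r.
  have : 0 < p0 * #|H|%:R by exact: mulr_gt0.
  by move: few; set h := #|H|%:R; set k := #|F|%:R => few ph phle; nra.
have -> : \sum_(e in H) (1 : R) ^+ 2 = #|H|%:R.
  by rewrite card_edge_sum; apply: eq_bigr => e _; rewrite expr1n.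
have -> : b * (p0 * #|H|%:R / 2) ^+ 2 = (b * p0 ^+ 2 * #|H|%:R) / 4 * #|H|%:R.
  by field.
by rewrite ler_peMl ?(ltW h0) //; lra.
Qed.

End Finite.

Theorem proposition8p1 (R : realType) (p0 eps : R)
    (hp0 : 0 < p0) (hp0' : p0 < 1) (heps : 0 < eps) :
  exists c : nat,
    forall (T : finType) (H : {set {set T}}),
      simple_graph H -> (c <= #|H|)%N ->
      forall p1 p2 : R, p0 <= p1 -> p1 < p2 -> p2 <= 1 ->
        nearly_dominates eps
          (random_subgraph p1 H) (@modularity R T)
          (random_subgraph p2 H) (@modularity R T).
Proof.
(* The relative sampling error d: the score may lose 18 d / p0^2, and the
   fraction of edges kept, at least p0 - d, must be at least p0 / 2. *)
have [d [d0 dp dpe]] : exists d : R,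
    [/\ 0 < d, 18 * d <= p0 ^+ 2 & 18 * d <= p0 ^+ 2 * eps].
  exists (p0 ^+ 2 * Num.min 1 eps / 18).
  have p2 : 0 < p0 ^+ 2 by exact: exprn_gt0.
  have -> : 18 * (p0 ^+ 2 * Num.min 1 eps / 18) = p0 ^+ 2 * Num.min 1 eps.
    by field.
  split.
  - by rewrite divr_gt0 // mulr_gt0 // lt_min ltr01.
  - by rewrite ler_piMr ?(ltW p2) // ge_min lexx.
  - by rewrite ler_pM2l // ge_min lexx orbT.
have c0 : 0 < eps * d ^+ 2 * p0 by rewrite !mulr_gt0 ?exprn_gt0.
have cge0 : 0 <= 24 / (eps * d ^+ 2 * p0) by rewrite divr_ge0 // ltW.
(* By Markov's inequality the sampling error of G exceeds (d |G|)^2 with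
   probability at most 6 / (d^2 |G|); this should be at most eps / 2 as soon as
   |G| >= p0 |H| / 2, that is, outside the event small. *)
exists (Num.bound (24 / (eps * d ^+ 2 * p0))).
move=> T H simpleH cH p1 p2 p01 p12 p21 t.
have : 24 < #|H|%:R * (eps * d ^+ 2 * p0).
  rewrite -ltr_pdivrMr //; apply: (lt_le_trans (archi_boundP cge0)).
  by rewrite ler_nat.
have : 0 <= #|H|%:R :> R by [].
move eqh : (#|H|%:R : R) => h h0 hbig.
have h_gt0 : 0 < h by rewrite -(pmulr_lgt0 _ c0); lra.
have H0 : (0 < #|H|)%N by rewrite -(ltr0n R) eqh.
have dp0 : d ^+ 2 <= p0.
  have : p0 ^+ 2 <= p0 by nra.
  have : d <= 1 by nra.
  by nra.
have p2_gt0 : 0 < p2 by lra.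
pose r := p1 / p2.
have r1 : r <= 1 by rewrite ler_pdivrMr // mul1r ltW.
have rp0 : p0 <= r by rewrite ler_pdivlMr //; nra.
pose small (F : {set {set T}}) := #|F|%:R < p0 * h / 2.
have few : Pr (random_subgraph p2 H) small <= eps / 2.
  rewrite /small -eqh; apply: Pr_few_edges => //; [lra | rewrite eqh].
  have : h * eps * p0 * d ^+ 2 <= h * eps * p0 * p0.
    by rewrite ler_wpM2l // !mulr_ge0 // ltW.
  by lra.
have -> : p1 = p2 * r by rewrite mulrC divfK // lt0r_neq0.
have rs0 G : 0 <= random_subgraph p2 H G by apply: random_subgraph_ge0; lra.
have rr0 G F : 0 <= random_subgraph r G F by apply: random_subgraph_ge0; lra.
rewrite Pr_random_subgraph_comp.
pose A (G : {set {set T}}) := t + eps <= modularity R G.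
(* Compare term by term over the intermediate graph G: a G of large modularity
   with many edges keeps it up to eps with probability 1 - eps/2, and for
   every other subgraph G of H the bracket is nonpositive. *)
apply: (@le_trans _ _ (\sum_(G : {set {set T}}) random_subgraph p2 H G *
    ((A G)%:R - (small G)%:R - eps / 2))).
  have PrE (B : pred {set {set T}}) : \sum_G random_subgraph p2 H G * (B G)%:R =
      Pr (random_subgraph p2 H) B.
    rewrite /Pr [RHS]big_mkcond; apply: eq_bigr => G _.
    by case: (B G); rewrite ?mulr1 ?mulr0.
  under eq_bigr do rewrite !mulrBr.
  by rewrite !sumrB !PrE -mulr_suml random_subgraph_sum1 mul1r /A; lra.
apply: ler_sum => G _.
case: (boolP (G \subset H)) => GH; last first.
  by rewrite {1 2}/random_subgraph (negPf GH) !mul0r.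
apply: ler_wpM2l => //.
have Pr0 : 0 <= Pr (random_subgraph r G) (fun F => t <= modularity R F).
  by apply: sumr_ge0.
case: (boolP (A G)) => AG; last by case: (small G) => /=; lra.
case: (boolP (small G)) => smallG /=; first by lra.
rewrite subr0.
have simpleG : simple_graph G.
  by apply/forall_inP => e /(subsetP GH); move/forall_inP: simpleH; apply.
have [[P partP GP] _] := modularity_max R G.
move: AG smallG; rewrite /A /small GP -leNgt => AG largeG.
have hp0h : 0 < p0 * h / 2 by rewrite divr_gt0 // mulr_gt0.
apply: (Pr_sample_keeps_score partP simpleG hp0 rp0 r1 d0 dp dpe) => //.
  by rewrite -(ltr0n R); lra.
have : eps * d ^+ 2 * (p0 * h / 2) <= eps * d ^+ 2 * #|G|%:R.
  by rewrite ler_wpM2l // mulr_ge0 ?sqr_ge0 // ltW.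
by lra.
Qed.
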